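(* Let $\mathbb{F}$ be a field and $\Gamma$ a finite group such that either $\mathrm{char}(\mathbb{F})=0$, or $\mathrm{char}(\mathbb{F})>0$ and $|\Gamma|$ and $\mathrm{char}(\mathbb{F})$ are coprime. Let $k\in\mathbb{N}$ be a constant. Then there is a constant $c$ depending only on $k$ such that for every finite set of variables $X$ on which $\Gamma$ acts and every $\Gamma$-invariant system of polynomial equations $\mathcal{F}\subseteq\mathbb{F}[X]$ that possesses an IPS refutation $C$ of semantic degree at most $k$, there exists a $\Gamma$-symmetric IPS refutation $C^{sym}$ of $\mathcal{F}$ with $|C^{sym}|\le c\,|\mathcal{F}|^{k}\le c\,|C|^{k}$. Moreover, if $C$ is $\vec y$-linear, then so is $C^{sym}$.
   Context: A system of polynomial equations is a finite set $\mathcal{F}=\{f_1,\dots,f_m\}\subseteq\mathbb{F}[X]$; its size is $|\mathcal{F}|:=m+|X|$. A group acting on $X$ acts on polynomials by substitution; $\mathcal{F}$ is $\Gamma$-invariant if $\{\pi(f):f\in\mathcal{F}\}=\mathcal{F}$ for all $\pi\in\Gamma$. An algebraic circuit over a variable set $Z$ and field $\mathbb{F}$ is a connected directed acyclic graph whose in-degree-$0$ gates are labelled by elements of $Z\cup\mathbb{F}$ and whose other gates are labelled $+$ or $\times$ (arbitrary fan-in), with a single output gate, computing a polynomial in the obvious way. Its semantic degree is the maximum degree of a polynomial computed at any of its gates. If $\Gamma$ acts on $Z$ (trivially on $\mathbb{F}$), the circuit is $\Gamma$-symmetric if every $\pi\in\Gamma$ extends to an automorphism $\sigma$ of the directed graph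 preserving labels of internal gates and satisfying $\lambda(\sigma(g))=\pi(\lambda(g))$ for input gates $g$. IPS: with fresh variables $Y=\{y_1,\dots,y_m\}$, an IPS certificate is $C(\vec x,\vec y)\in\mathbb{F}[X\uplus Y]$ with $C(\vec x,\vec 0)=0$ and $C(\vec x,f_1,\dots,f_m)=1$; an IPS refutation is an algebraic circuit over $X\uplus Y$ computing one. The size of a refutation with gate set $D$ is $|C|:=\max(|D|,|X|+|Y|)$. It is $\vec y$-linear if the certificate has the form $\sum_{i=1}^m y_i g_i(\vec x)$. For $\Gamma$-invariant $\mathcal{F}$, $\Gamma$ acts on $Y$ by $\pi(y_i)=y_j$ where $\pi(f_i)=f_j$; a $\Gamma$-symmetric IPS refutation is an IPS refutation that is a $\Gamma$-symmetric circuit w.r.t. this action on $X\uplus Y$. *)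

(* Defs.v *)
From HB Require Import structures.
From mathcomp Require Import all_boot all_algebra all_fingroup.
From mathcomp Require Import mpoly.

Set Implicit Arguments.
Unset Strict Implicit.
Unset Printing Implicit Defensive.

Import GRing.Theory.
Local Open Scope ring_scope.

Definition mdegree (F : fieldType) (n : nat) (p : {mpoly F[n]}) : nat :=
  (msize p).-1.

Definition msubst (F : fieldType) (n k : nat) (h : 'I_n -> {mpoly F[k]})
    (p : {mpoly F[n]}) : {mpoly F[k]} :=
  p \mPo [tuple h i | i < n].

Inductive gate_label (F : fieldType) (N : nat) :=
  | LVar of 'I_N
  | LConst of F
  | LAdd
  | LMul.

Arguments LVar {F N}.
Arguments LConst {F N}.
Arguments LAdd {F N}.
Arguments LMul {F N}.

Definition is_input_label (F : fieldType) (N : nat) (l : gate_label F N) : bool :=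
  match l with LVar _ | LConst _ => true | LAdd | LMul => false end.

(* [wire g h] is the edge from [g] to [h]: [g] is one of the operands of [h].
   The graph is simple, so an operand is used at most once by a given gate;
   distinct input gates may carry the same label. *)
Record circuit (F : fieldType) (N : nat) := Circuit {
  gate : finType;
  wire : rel gate;
  label : gate -> gate_label F N;
  output : gate;
  wire_acyclic : forall g h : gate, wire g h -> ~~ connect wire h g;
  wire_connected : forall g h : gate,
    connect (fun a b => wire a b || wire b a) g h;
  label_input : forall g : gate,
    is_input_label (label g) = [forall h, ~~ wire h g];
  output_unique : forall g : gate, [forall h, ~~ wire g h] = (g == output)
}.

Section CircuitSemantics.

Variables (F : fieldType) (N : nat) (C : circuit F N).

(* The first argument is recursion fuel; [gate_polyE] below shows that #|gate C|
   is always enough. *)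
Fixpoint gate_poly_rec (d : nat) (g : gate C) : {mpoly F[N]} :=
  match d with
  | 0%N => 0
  | d'.+1 =>
    match label g with
    | LVar z => 'X_z
    | LConst a => a%:MP
    | LAdd => \sum_(h : gate C | wire h g) gate_poly_rec d' h
    | LMul => \prod_(h : gate C | wire h g) gate_poly_rec d' h
    end
  end.

Definition gate_poly (g : gate C) : {mpoly F[N]} :=
  gate_poly_rec #|gate C| g.

Definition circuit_poly : {mpoly F[N]} := gate_poly (output C).

Definition semantic_degree : nat := \max_(g : gate C) mdegree (gate_poly g).

Lemma gate_poly_rec_stable (d e : nat) (g : gate C) :
  (#|[pred h | connect (@wire _ _ C) h g]| <= d)%N ->
  (#|[pred h | connect (@wire _ _ C) h g]| <= e)%N ->
  gate_poly_rec d g = gate_poly_rec e g.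
Proof.
have pos h : (0 < #|[pred a | connect (@wire _ _ C) a h]|)%N.
  by apply/card_gt0P; exists h; rewrite inE connect0.
have dec a h : wire a h -> (#|[pred b | connect (@wire _ _ C) b a]| <
    #|[pred b | connect (@wire _ _ C) b h]|)%N.
  move=> ah; apply: proper_card; apply/properP; split.
    apply/subsetP=> b; rewrite !inE => ba.
    exact: connect_trans ba (connect1 ah).
  by exists h; rewrite inE ?connect0 //; exact: wire_acyclic ah.
have nle0 h : (#|[pred a | connect (@wire _ _ C) a h]| <= 0)%N = false.
  by rewrite leqNgt pos.
elim: d e g => [|d IHd] [|e] g; rewrite ?nle0 // => led lee /=.
have IH h : wire h g -> gate_poly_rec d h = gate_poly_rec e h.
  move=> hg; apply: IHd; rewrite -ltnS.
    exact: leq_trans (dec _ _ hg) led.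
  exact: leq_trans (dec _ _ hg) lee.
by case: (label g) => //; apply: eq_bigr.
Qed.

Lemma gate_polyE (g : gate C) :
  gate_poly g =
    match label g with
    | LVar z => 'X_z
    | LConst a => a%:MP
    | LAdd => \sum_(h : gate C | wire h g) gate_poly h
    | LMul => \prod_(h : gate C | wire h g) gate_poly h
    end.
Proof.
rewrite {1}/gate_poly (@gate_poly_rec_stable _ #|gate C|.+1) ?max_card //.
exact: leq_trans (max_card _) (leqnSn _).
Qed.

End CircuitSemantics.

Definition label_act (F : fieldType) (N : nat) (s : 'I_N -> 'I_N)
    (l : gate_label F N) : gate_label F N :=
  match l with
  | LVar z => LVar (s z)
  | LConst a => LConst a
  | LAdd => LAdd
  | LMul => LMul
  end.

Definition circuit_symmetric (F : fieldType) (N : nat) (gT : finGroupType)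
    (act : gT -> 'I_N -> 'I_N) (C : circuit F N) : Prop :=
  forall pi : gT, exists sigma : {perm gate C},
    (forall g h : gate C, wire (sigma g) (sigma h) = wire g h) /\
    (forall g : gate C, label (sigma g) = label_act (act pi) (label g)).

(* The variable set X is 'I_n, on which the finite group acts through [to].  A
   system is a duplicate-free tuple [f] of m polynomials, Y is 'I_m, and X + Y is
   'I_(n + m), with [lshift m x] standing for x in X and [rshift n i] for y_i. *)
Section Systems.

Variables (F : fieldType) (gT : finGroupType) (n m : nat).
Variables (to : {action gT &-> 'I_n}) (f : m.-tuple {mpoly F[n]}).

Definition poly_act (pi : gT) (p : {mpoly F[n]}) : {mpoly F[n]} :=
  msubst (fun x => 'X_(to x pi)) p.

Definition system_invariant : Prop :=
  forall pi : gT, [seq poly_act pi p | p <- f] =i f.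

Definition system_size : nat := (m + n)%N.

(* The [else] branch is never taken when the system is invariant; see
   [tnth_yvar_act]. *)
Definition yvar_act (pi : gT) (i : 'I_m) : 'I_m :=
  if [pick j | tnth f j == poly_act pi (tnth f i)] is Some j then j else i.

Lemma tnth_yvar_act (pi : gT) (i : 'I_m) :
  system_invariant -> tnth f (yvar_act pi i) = poly_act pi (tnth f i).
Proof.
move=> inv; rewrite /yvar_act; case: pickP => [j /eqP//|no].
have /tnthP[j Ej] : poly_act pi (tnth f i) \in f.
  by rewrite -(inv pi) map_f ?mem_tnth.
by have := no j; rewrite /= Ej eqxx.
Qed.

Definition xyvar_act (pi : gT) (z : 'I_(n + m)) : 'I_(n + m) :=
  match split z with
  | inl x => lshift m (to x pi)
  | inr i => rshift n (yvar_act pi i)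
  end.

Definition subst_y (h : 'I_m -> {mpoly F[n]}) (p : {mpoly F[n + m]}) :
    {mpoly F[n]} :=
  msubst (fun z => match split z with inl x => 'X_x | inr i => h i end) p.

Definition ips_certificate (p : {mpoly F[n + m]}) : Prop :=
  subst_y (fun _ => 0) p = 0 /\ subst_y (tnth f) p = 1.

Definition ips_refutation (C : circuit F (n + m)) : Prop :=
  ips_certificate (circuit_poly C).

Definition refutation_size (C : circuit F (n + m)) : nat :=
  maxn #|gate C| (n + m).

Definition y_linear (C : circuit F (n + m)) : Prop :=
  exists g : 'I_m -> {mpoly F[n]},
    circuit_poly C =
      \sum_(i < m) 'X_(rshift n i) * msubst (fun x => 'X_(lshift m x)) (g i).

Definition symmetric_ips_refutation (C : circuit F (n + m)) : Prop :=
  ips_refutation C /\ circuit_symmetric xyvar_act C.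

End Systems.

(* Main.v *)
(** Averaging the certificate over the group yields an invariant certificate of
    the same degree, provided the order of the group is invertible in the field.
    An invariant polynomial of degree at most [k] is then computed by its
    expanded form: one product gate and one coefficient gate for each of the
    [O(N^k)] monomials of degree at most [k], including those with coefficient
    [0].  The group permutes the monomials and preserves the coefficients, so
    this depth-two circuit is symmetric. *)

Require Import Defs.
From HB Require Import structures.
From mathcomp Require Import all_boot all_algebra all_fingroup.
From mathcomp Require Import mpoly.

Set Implicit Arguments.
Unset Strict Implicit.
Unset Printing Implicit Defensive.

Import GRing.Theory.

(** * Composing substitutions with permutations of the variables *)

Section Substitution.

Local Open Scope ring_scope.

Variable F : fieldType.

Lemma msubstX (a b : nat) (h : 'I_a -> {mpoly F[b]}) (i : 'I_a) :
  msubst h 'X_i = h i.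
Proof. by rewrite /msubst comp_mpolyXU -tnth_nth tnth_mktuple. Qed.

Lemma eq_msubst (a b : nat) (h1 h2 : 'I_a -> {mpoly F[b]}) :
  h1 =1 h2 -> msubst h1 =1 msubst h2.
Proof.
move=> eqh p; rewrite /msubst; congr (_ \mPo _).
by apply: eq_from_tnth => i; rewrite !tnth_mktuple.
Qed.

Lemma msubst_msubst (a b c : nat) (h : 'I_a -> {mpoly F[b]})
    (u : 'I_b -> {mpoly F[c]}) (p : {mpoly F[a]}) :
  msubst u (msubst h p) = msubst (fun i => msubst u (h i)) p.
Proof.
rewrite /msubst !(comp_mpolyEX p) (raddf_sum (comp_mpoly _)) /=.
apply: eq_bigr => d _; rewrite !comp_mpolyZ !comp_mpolyX rmorph_prod /=; congr (_ *: _).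
by apply: eq_bigr => i _; rewrite rmorphXn /= !tnth_mktuple.
Qed.

Lemma msubst_id (a : nat) (p : {mpoly F[a]}) : msubst (fun i => 'X_i) p = p.
Proof. exact: comp_mpoly_id. Qed.

Lemma msubst_msym (a b : nat) (h : 'I_a -> {mpoly F[b]}) (s : 'S_a) p :
  msubst h (msym s p) = msubst (fun i => h (s i)) p.
Proof.
rewrite /msubst msym_mPo; congr (_ \mPo _).
by apply: eq_from_tnth => i; rewrite !tnth_mktuple.
Qed.

Lemma msymXU (a : nat) (s : 'S_a) (i : 'I_a) :
  msym s 'X_i = 'X_(s i) :> {mpoly F[a]}.
Proof. by rewrite /msym mmapX mmap1U. Qed.

Lemma msym_msubst (a b : nat) (h : 'I_a -> {mpoly F[b]}) (s : 'S_b) p :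
  msym s (msubst h p) = msubst (fun i => msym s (h i)) p.
Proof.
have E (q : {mpoly F[b]}) : msym s q = msubst (fun j => 'X_(s j)) q.
  by rewrite -[LHS]msubst_id msubst_msym.
by rewrite E msubst_msubst; apply: eq_msubst => i; rewrite E.
Qed.

End Substitution.

(** * Averaging a polynomial over the group *)

Section Reynolds.

Local Open Scope ring_scope.

Variables (F : fieldType) (gT : finGroupType) (N : nat).
Variable A : {action gT &-> 'I_N}.

Definition reynolds (p : {mpoly F[N]}) : {mpoly F[N]} :=
  #|gT|%:R^-1 *: \sum_(g : gT) msym (actperm A g) p.

(** Applying [h] and then [g] is applying [h * g], and right translation by [g] only permutes the
    summands. *)
Lemma msym_reynolds (g : gT) p : msym (actperm A g) (reynolds p) = reynolds p.
Proof.
rewrite /reynolds msymZ (raddf_sum (msym _)) /=; congr (_ *: _).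
rewrite [RHS](reindex_inj (mulIg g)) /=; apply: eq_bigr => h _.
by rewrite actpermM ?inE // msymMm.
Qed.

Lemma msize_msym (s : 'S_N) (p : {mpoly F[N]}) : (msize (msym s p) <= msize p)%N.
Proof.
rewrite [in leqLHS]msizeE; apply/bigmax_leqP_seq => d d_in _.
rewrite -(mdeg_mperm d s) msize_mdeg_lt //.
by rewrite mcoeff_msupp -mcoeff_sym -mcoeff_msupp.
Qed.

Lemma msize_reynolds p : (msize (reynolds p) <= msize p)%N.
Proof.
apply: leq_trans (msizeZ_le _ _) _; apply: leq_trans (mmeasure_sum _ _ _ _) _.
by apply/bigmax_leqP => g _; apply: msize_msym.
Qed.

End Reynolds.

(** * Counting monomials of bounded degree *)

(** Induction on [k]: a monomial of degree at most [k + 1] is recovered from an optional variable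
    dividing it and the quotient, of degree at most [k]. Each step thus costs a factor [N + 1]. *)
Lemma card_bmultinom (N k : nat) : #|{: 'X_{1..N < k.+1}}| <= N.+1 ^ k.
Proof.
elim: k => [|k IHk].
  rewrite expn0; apply/card_le1_eqP => a b _ _; apply/val_inj => /=.
  have z (c : 'X_{1..N < 1}) : bmnm c = 0%MM.
    by apply/eqP; rewrite -mdeg_eq0 -leqn0 -ltnS bmdeg.
  by rewrite !z.
pose dec (o : option 'I_N) := if o is Some z then U_(z)%MM else 0%MM.
pose pos (d : 'X_{1..N < k.+2}) := [pick z | bmnm d z != 0%N].
(* The default [bm0] of [insubd] never distorts the quotient: either a variable is split off and the
   degree drops by one, or all exponents are 0 and so is the quotient. *)
pose enc (d : 'X_{1..N < k.+2}) : option 'I_N * 'X_{1..N < k.+1} :=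
  (pos d, insubd bm0 (bmnm d - dec (pos d))%MM).
have decK d : (bmnm (enc d).2 + dec (enc d).1 = bmnm d)%MM.
  rewrite /enc /=; set q := (_ - _)%MM.
  have qK : (q + dec (pos d) = bmnm d)%MM.
    apply: submK; rewrite /pos; case: pickP => [z nz|_] /=; last first.
      by apply/mnm_lepP => z; rewrite mnm0E.
    by rewrite lep1mP.
  rewrite val_insubd ifT //; move: (bmdeg d); rewrite -qK mdegD.
  rewrite /q /dec /pos; case: pickP => [z nz|no] /=; first by rewrite mdeg1 addn1.
  have ->: bmnm d = 0%MM.
    by apply/mnmP => z; rewrite mnm0E; apply/eqP; move/negbFE: (no z).
  by rewrite subm0 mdeg0.
have enc_inj : injective enc.
  by move=> a b eqab; apply: val_inj; rewrite /= -decK eqab decK.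
apply: leq_trans (leq_card enc enc_inj) _.
by rewrite card_prod card_option card_ord expnS leq_mul2l IHk orbT.
Qed.

(** * The circuit of the expanded form *)

Section ExpandedCircuit.

Local Open Scope ring_scope.

Variables (F : fieldType) (N k : nat) (P : {mpoly F[N]}).

Local Notation mon := ('X_{1..N < k.+1}).

(* The product gates, the coefficient gates, [k] copies of each variable, and the
   output gate. Copies are needed since a gate uses an operand at most once: the
   product gate of [d] uses the first [d z] copies of [z]. *)
Definition exp_gate : finType := (mon + mon + 'I_N * 'I_k + unit)%type.

Definition exp_wire : rel exp_gate := fun a b =>
  match a, b with
  | inl (inl (inl _)), inr _ => true
  | inl (inl (inr d)), inl (inl (inl e)) => d == e
  | inl (inr (z, j)), inl (inl (inl e)) => (j < bmnm e z)%N
  | _, _ => false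
  end.

Definition exp_label (a : exp_gate) : gate_label F N :=
  match a with
  | inl (inl (inl _)) => LMul
  | inl (inl (inr d)) => LConst P@_(bmnm d)
  | inl (inr (z, _)) => LVar z
  | inr _ => LAdd
  end.

Definition exp_output : exp_gate := inr tt.

(** A rank that increases strictly along wires, which rules out cycles. *)
Definition exp_depth (a : exp_gate) : nat :=
  match a with inl (inl (inl _)) => 1 | inr _ => 2 | _ => 0 end.

Lemma exp_wire_depth a b : exp_wire a b -> (exp_depth a < exp_depth b)%N.
Proof. by case: a => [[[a|a]|[z j]]|a]; case: b => [[[b|b]|[y i]]|b]. Qed.

Lemma exp_connect_depth a b :
  connect exp_wire a b -> (exp_depth a <= exp_depth b)%N.
Proof.
case/connectP=> p; elim: p a => [|c p IHp] a /=; first by move=> _ ->.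
case/andP=> /exp_wire_depth ac pth lst.
exact: leq_trans (ltnW ac) (IHp _ pth lst).
Qed.

Lemma exp_acyclic a b : exp_wire a b -> ~~ connect exp_wire b a.
Proof.
move/exp_wire_depth => lt_ab; apply/negP => /exp_connect_depth.
by rewrite leqNgt lt_ab.
Qed.

(** The monomial [z ^ (j + 1)] uses copy [j] of [z], and [j < k] keeps its degree at most [k]. Hence
    no copy dangles, whatever the coefficients of [P]; connectedness and uniqueness of the output
    rest on this. *)
Lemma exp_var_wired (z : 'I_N) (j : 'I_k) :
  {d : mon | exp_wire (inl (inr (z, j))) (inl (inl (inl d)))}.
Proof.
have lt : (mdeg (U_(z) *+ j.+1)%MM < k.+1)%N.
  by rewrite mdegMn mdeg1 mul1n ltnS.
by exists (BMultinom lt); rewrite /= mulmnE mnm1E eqxx mul1n.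
Qed.

Lemma exp_connect_output a : connect exp_wire a exp_output.
Proof.
have prod_out d : connect exp_wire (inl (inl (inl d))) exp_output.
  exact: connect1.
case: a => [[[d|d]|[z j]]|[]]; last exact: connect0.
- exact: prod_out.
- by apply: connect_trans (prod_out d); apply: connect1; rewrite /= eqxx.
- have [d zd] := exp_var_wired z j.
  exact: connect_trans (connect1 zd) (prod_out d).
Qed.

Lemma exp_connected a b :
  connect (fun a b => exp_wire a b || exp_wire b a) a b.
Proof.
set e := fun _ _ => _.
have e_sym : connect_sym e.
  by apply: sym_connect_sym => x y; rewrite /e orbC.
have toout x : connect e x exp_output.
  apply: connect_sub (exp_connect_output x) => u v uv.
  by apply: connect1; rewrite /e uv.
by apply: connect_trans (toout a) _; rewrite e_sym.
Qed.

Lemma exp_label_input a :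
  is_input_label (exp_label a) = [forall b, ~~ exp_wire b a].
Proof.
case: a => [[[d|d]|[z j]]|[]] /=; apply/esym.
- by apply/negbTE/forallPn; exists (inl (inl (inr d))); rewrite /= eqxx.
- by apply/forallP => -[[[e|e]|[y i]]|e].
- by apply/forallP => -[[[e|e]|[y i]]|e].
(* The constant monomial gives the sum gate an operand for every [N] and [k]. *)
- by apply/negbTE/forallPn; exists (inl (inl (inl bm0))).
Qed.

Lemma exp_output_unique a : [forall b, ~~ exp_wire a b] = (a == exp_output).
Proof.
case: a => [[[d|d]|[z j]]|[]] /=.
- by apply/negbTE/forallPn; exists exp_output.
- by apply/negbTE/forallPn; exists (inl (inl (inl d))); rewrite /= eqxx.
- by apply/negbTE/forallPn; have [d zd] := exp_var_wired z j;
    exists (inl (inl (inl d))); rewrite negbK.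
- by rewrite eqxx; apply/forallP => -[[[e|e]|[y i]]|e].
Qed.

Definition exp_circuit : circuit F N :=
  Circuit exp_acyclic exp_connected exp_label_input exp_output_unique.

Lemma card_exp_gate :
  (#|gate exp_circuit| <= 2 * N.+1 ^ k + N * k + 1)%N.
Proof.
rewrite /= !card_sum card_prod !card_ord card_unit leq_add2r leq_add2r.
by rewrite addnn -mul2n leq_mul2l card_bmultinom.
Qed.

Lemma exp_circuit_poly : (msize P <= k.+1)%N -> circuit_poly exp_circuit = P.
Proof.
move=> szP; rewrite /circuit_poly gate_polyE /= !big_sumType /=.
rewrite !big_pred0_eq [X in _ + X + _]big_pred0; last by case.
rewrite !addr0 [RHS](mpolywE szP); apply: eq_bigr => d _.
rewrite gate_polyE /= !big_sumType /=.
rewrite !big_pred0_eq mul1r mulr1 (big_pred1 d) // gate_polyE /= mul_mpolyC.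
congr (_ *: _).
rewrite mpolyXE_id; transitivity
  (\prod_(z < N) \prod_(j < k | (j < bmnm d z)%N) ('X_z : {mpoly F[N]})).
  rewrite pair_big_dep /=; apply: eq_big => [[z j]|[z j] _] //.
  by rewrite gate_polyE.
(* An exponent is at most the total degree, hence at most [k], so exactly [d z] of the [k] copies of
   [z] pass the test. *)
apply: eq_bigr => z _; have le_dk : (bmnm d z <= k)%N.
  rewrite -ltnS; apply: leq_ltn_trans (bmdeg d).
  by rewrite mdegE (bigD1 z) //= leq_addr.
by rewrite (big_ord_narrow le_dk) prodr_const card_ord.
Qed.

(** * Circuit automorphisms induced by variable permutations *)

Section Symmetry.

Variable s : 'S_N.

Lemma mon_perm_proof (d : mon) :
  (mdeg [multinom bmnm d ((s^-1)%g i) | i < N] < k.+1)%N.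
Proof. by rewrite mdeg_mperm bmdeg. Qed.

Definition mon_perm (d : mon) : mon := BMultinom (mon_perm_proof d).

Lemma mon_permE d z : bmnm (mon_perm d) (s z) = bmnm d z.
Proof. by rewrite mnmE permK. Qed.

Lemma mon_perm_inj : injective mon_perm.
Proof.
move=> d e eq_de; apply: val_inj; apply/mnmP => z /=.
by rewrite -(mon_permE d) eq_de mon_permE.
Qed.

(** The copy index [j] is kept: the exponent of [s z] in [mon_perm d] is that of [z] in [d], so the
    wiring test [j < d z] is unaffected. *)
Definition exp_gate_perm (a : exp_gate) : exp_gate :=
  match a with
  | inl (inl (inl d)) => inl (inl (inl (mon_perm d)))
  | inl (inl (inr d)) => inl (inl (inr (mon_perm d)))
  | inl (inr (z, j)) => inl (inr (s z, j))
  | inr u => inr u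
  end.

Lemma exp_gate_perm_inj : injective exp_gate_perm.
Proof.
case=> [[[d|d]|[z j]]|u]; case=> [[[e|e]|[y i]]|v] //=.
- move/eqP=> eq_de.
  by rewrite (mon_perm_inj (eqP (eq_de : mon_perm d == mon_perm e))).
- move/eqP=> eq_de.
  by rewrite (mon_perm_inj (eqP (eq_de : mon_perm d == mon_perm e))).
- by case=> /perm_inj-> ->.
Qed.

Lemma exp_gate_perm_wire a b :
  exp_wire (exp_gate_perm a) (exp_gate_perm b) = exp_wire a b.
Proof.
case: a => [[[d|d]|[z j]]|u]; case: b => [[[e|e]|[y i]]|v] //=.
  by rewrite (inj_eq mon_perm_inj).
by rewrite mnmE permK.
Qed.

(** For coefficient gates, invariance of [P] says that [d] and [mon_perm d] have equal
    coefficients. *)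
Lemma exp_gate_perm_label a : msym s P = P ->
  exp_label (exp_gate_perm a) = label_act s (exp_label a).
Proof.
move=> symP; case: a => [[[d|d]|[z j]]|u] //=; congr LConst.
rewrite -[in LHS]symP mcoeff_sym; congr _@__.
by apply/mnmP => i; rewrite !mnmE permK.
Qed.

End Symmetry.

Lemma exp_circuit_symmetric (gT : finGroupType) (act : gT -> 'I_N -> 'I_N)
    (s : gT -> 'S_N) :
  (forall g, s g =1 act g) -> (forall g, msym (s g) P = P) ->
  circuit_symmetric act exp_circuit.
Proof.
move=> sE symP g; exists (perm (exp_gate_perm_inj (s := s g))).
split=> [a b|a]; rewrite !permE; first exact: exp_gate_perm_wire.
rewrite /= exp_gate_perm_label //; case: (exp_label a) => //= z.
by rewrite sE.
Qed.

End ExpandedCircuit.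

(** * The action on X and Y, and its effect on certificates *)

Section SystemAction.

Local Open Scope ring_scope.

Variables (F : fieldType) (gT : finGroupType) (n m : nat).
Variables (to : {action gT &-> 'I_n}) (f : m.-tuple {mpoly F[n]}).
Hypotheses (f_uniq : uniq f) (f_inv : system_invariant to f).

Lemma poly_actM g h (p : {mpoly F[n]}) :
  poly_act to (g * h)%g p = poly_act to h (poly_act to g p).
Proof.
rewrite /poly_act msubst_msubst; apply: eq_msubst => x.
by rewrite msubstX actM.
Qed.

Lemma poly_act1 (p : {mpoly F[n]}) : poly_act to 1%g p = p.
Proof.
by rewrite -[RHS]msubst_id; apply: eq_msubst => x; rewrite act1.
Qed.

(** Since [f] has no duplicates, an index is determined by its polynomial, so the action laws on Y
    are inherited from [poly_act]. *)
Lemma yvar_act1 i : yvar_act to f 1 i = i.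
Proof. by apply: (tuple_uniqP _ f_uniq); rewrite tnth_yvar_act // poly_act1. Qed.

Lemma yvar_actM i g h :
  yvar_act to f (g * h)%g i = yvar_act to f h (yvar_act to f g i).
Proof. by apply: (tuple_uniqP _ f_uniq); rewrite !tnth_yvar_act // poly_actM. Qed.

Lemma xyvar_act_lshift g x : xyvar_act to f g (lshift m x) = lshift m (to x g).
Proof. by rewrite /xyvar_act (unsplitK (inl _)). Qed.

Lemma xyvar_act_rshift g i :
  xyvar_act to f g (rshift n i) = rshift n (yvar_act to f g i).
Proof. by rewrite /xyvar_act (unsplitK (inr _)). Qed.

Lemma xyvar_act1 z : xyvar_act to f 1%g z = z.
Proof.
case: (split_ordP z) => [x ->|i ->].
  by rewrite xyvar_act_lshift act1.
by rewrite xyvar_act_rshift yvar_act1.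
Qed.

Lemma xyvar_actM z : act_morph (fun z g => xyvar_act to f g z) z.
Proof.
move=> g h; case: (split_ordP z) => [x ->|i ->].
  by rewrite !xyvar_act_lshift actM.
by rewrite !xyvar_act_rshift yvar_actM.
Qed.

Definition xyvar_action : {action gT &-> 'I_(n + m)} :=
  TotalAction xyvar_act1 xyvar_actM.

Local Notation xyperm := (actperm xyvar_action).

(** The hypothesis is equivariance of [h]. It holds for [h = 0] and for [h = tnth f], so both
    certificate conditions are covered at once. *)
Lemma subst_y_msym g (h : 'I_m -> {mpoly F[n]}) p :
    (forall i, h (yvar_act to f g i) = poly_act to g (h i)) ->
  subst_y h (msym (xyperm g) p) = poly_act to g (subst_y h p).
Proof.
move=> hE; rewrite /subst_y msubst_msym /poly_act msubst_msubst.
apply: eq_msubst => z; rewrite actpermE /=.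
case: (split_ordP z) => [x ->|i ->].
  by rewrite xyvar_act_lshift !(unsplitK (inl _)) msubstX.
by rewrite xyvar_act_rshift !(unsplitK (inr _)) hE.
Qed.

(** The action fixes constants, so every summand evaluates to [c]; the sum is [#|gT|] times [c], and
    invertibility of [#|gT|] recovers [c]. *)
Lemma subst_y_reynolds (h : 'I_m -> {mpoly F[n]}) (p : {mpoly F[n + m]}) (c : F) :
    #|gT|%:R != 0 :> F ->
    (forall g i, h (yvar_act to f g i) = poly_act to g (h i)) ->
  subst_y h p = c%:MP -> subst_y h (reynolds xyvar_action p) = c%:MP.
Proof.
move=> nz hE pc; rewrite /reynolds /subst_y /msubst comp_mpolyZ (raddf_sum (comp_mpoly _)) /=.
rewrite (eq_bigr (fun=> c%:MP)) => [|g _].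
  by rewrite sumr_const -scaler_nat scalerA mulVf // scale1r.
rewrite -/(msubst _ _) -/(subst_y _ _) subst_y_msym // pc.
by rewrite /poly_act /msubst comp_mpolyC.
Qed.

Lemma ips_certificate_reynolds (p : {mpoly F[n + m]}) : #|gT|%:R != 0 :> F ->
  ips_certificate f p -> ips_certificate f (reynolds xyvar_action p).
Proof.
move=> nz [p0 p1]; split; [rewrite -mpolyC0 | rewrite -mpolyC1].
  by apply: subst_y_reynolds => // g i; rewrite /poly_act /msubst comp_mpoly0.
by apply: subst_y_reynolds => // g i; rewrite tnth_yvar_act.
Qed.

Definition y_linear_poly (p : {mpoly F[n + m]}) : Prop :=
  exists g : 'I_m -> {mpoly F[n]},
    p = \sum_(i < m) 'X_(rshift n i) * msubst (fun x => 'X_(lshift m x)) (g i).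

Lemma y_linear_reynolds p :
  y_linear_poly p -> y_linear_poly (reynolds xyvar_action p).
Proof.
case=> q ->; pose c := #|gT|%:R^-1 : F.
(* Applying [g] sends [y_i * q_i] to [y_(g i) * g(q_i)], so the contribution of [g] to the
   coefficient of [y_i] comes from the index [g^-1 i]. *)
exists (fun i => c *: \sum_(g : gT) poly_act to g (q (yvar_act to f g^-1%g i))).
have msymL g (r : {mpoly F[n]}) :
    msym (xyperm g) (msubst (fun x => 'X_(lshift m x)) r) =
    msubst (fun x => 'X_(lshift m x)) (poly_act to g r).
  rewrite msym_msubst /poly_act msubst_msubst; apply: eq_msubst => x.
  by rewrite msymXU msubstX actpermE /= xyvar_act_lshift.
transitivity (c *: \sum_(g : gT) \sum_(i < m) 'X_(rshift n i) *
    msubst (fun x => 'X_(lshift m x)) (poly_act to g (q (yvar_act to f g^-1%g i)))).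
  congr (_ *: _); apply: eq_bigr => g _; rewrite (raddf_sum (msym _)) /=.
  have yK : cancel (yvar_act to f g) (yvar_act to f g^-1%g).
    by move=> i; rewrite -yvar_actM mulgV yvar_act1.
  rewrite [RHS](reindex_inj (can_inj yK)) /=; apply: eq_bigr => i _.
  by rewrite msymM msymL msymXU actpermE /= xyvar_act_rshift yK.
rewrite exchange_big scaler_sumr /=; apply: eq_bigr => i _.
rewrite -mulr_sumr scalerAr /msubst comp_mpolyZ; congr (_ * (_ *: _)).
by rewrite (raddf_sum (comp_mpoly _)).
Qed.

(** Without equations the two substitutions coincide, forcing [0 = 1]. This makes [n + m] positive
    in the size bound. *)
Lemma ips_certificate_eqn_gt0 p : ips_certificate f p -> (0 < m)%N.
Proof.
case=> p0 p1; rewrite lt0n; apply/eqP => m0.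
have := oner_neq0 {mpoly F[n]}; rewrite -p1 -p0 => /eqP; apply.
apply: eq_msubst => z; case: (split z) => // i.
by move: (ltn_ord i); rewrite [X in (_ < X)%N]m0.
Qed.

(** Both substitutions fix constants, so a constant certificate would force [0 = 1]. A degree bound
    [k] is therefore at least 1. *)
Lemma ips_certificate_msize p : ips_certificate f p -> (1 < msize p)%N.
Proof.
case=> p0 p1; rewrite ltnNge; apply/negP => /msize1_polyC pC.
have := oner_neq0 {mpoly F[n]}; rewrite -p1 -p0 pC => /eqP; apply.
by rewrite /subst_y /msubst !comp_mpolyC.
Qed.

End SystemAction.

(** * Invertibility of the group order, size bound and assembly *)

Lemma natr_card_neq0 (F : fieldType) (gT : finGroupType) :
    [pchar F]%R =i pred0 \/ (exists p : nat, p \in [pchar F]%R /\ coprime #|gT| p) ->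
  (#|gT|%:R != 0 :> F)%R.
Proof.
have gT_gt0 : 0 < #|gT| by apply/card_gt0P; exists 1%g.
case=> [/pcharf0P->|[p [pF cop]]]; first by rewrite -lt0n.
rewrite -(dvdn_pcharf pF); apply/negP => pg.
have := pcharf_prime pF; rewrite -(gcdn_idPr pg).
by move: cop; rewrite /coprime => /eqP->.
Qed.

(** Positivity gives [N + 1 <= 2 * N], [1 <= N ^ k] and [N <= N ^ k], so each summand of the gate
    count is at most a constant times [N ^ k]. *)
Lemma exp_gate_bound (N k : nat) : 0 < N -> 0 < k ->
  maxn (2 * N.+1 ^ k + N * k + 1) N <= (2 * 2 ^ k + k + 1) * N ^ k.
Proof.
move=> N0 k0; have NNk : N <= N ^ k by rewrite -{1}[N]expn1 leq_pexp2l.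
have Nk0 : 0 < N ^ k by rewrite expn_gt0 N0.
have SN : N.+1 ^ k <= 2 ^ k * N ^ k.
  by rewrite -expnMn leq_exp2r // mul2n -addnn -addn1 leq_add2l.
rewrite geq_max; apply/andP; split; last first.
  by apply: leq_trans NNk _; rewrite leq_pmull // addn1.
rewrite 2!mulnDl mul1n -mulnA !leq_add // ?leq_mul2l ?SN //.
by rewrite mulnC leq_mul2l NNk orbT.
Qed.

Theorem theorem4p4 (k : nat) :
  exists c : nat,
    forall (F : fieldType) (gT : finGroupType),
      ([pchar F]%R =i pred0 \/
       exists p : nat, p \in [pchar F]%R /\ coprime #|gT| p) ->
    forall (n m : nat) (to : {action gT &-> 'I_n}) (f : m.-tuple {mpoly F[n]}),
      uniq f -> system_invariant to f ->
    forall C : circuit F (n + m),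
      ips_refutation f C -> (semantic_degree C <= k)%N ->
    exists Csym : circuit F (n + m),
      symmetric_ips_refutation to f Csym /\
      (refutation_size Csym <= c * system_size n m ^ k)%N /\
      (c * system_size n m ^ k <= c * refutation_size C ^ k)%N /\
      (y_linear C -> y_linear Csym).
Proof.
(* The summands account for the product and coefficient gates, the variable copies, and the output
   gate. *)
exists (2 * 2 ^ k + k + 1) => F gT charF n m to f f_uniq f_inv C certC degC.
set P := circuit_poly C in certC.
have szP : msize P <= k.+1.
  (* [mdegree] is the predecessor of [msize], whence the shift by one; the semantic degree bounds
     the degree at the output gate. *)
  apply: leq_trans (leqSpred _) _; rewrite ltnS.
  by apply: leq_trans degC; exact: (leq_bigmax (output C)).
have k0 : 0 < k by rewrite -ltnS (leq_trans (ips_certificate_msize certC)).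
have N0 : 0 < n + m by rewrite addn_gt0 (ips_certificate_eqn_gt0 certC) orbT.
pose A := xyvar_action f_uniq f_inv; pose Q := reynolds A P.
have CQ : circuit_poly (exp_circuit k Q) = Q.
  exact/exp_circuit_poly/(leq_trans (msize_reynolds A P)).
exists (exp_circuit k Q); split; [split | split; [|split]].
- by rewrite /ips_refutation CQ; apply: ips_certificate_reynolds => //;
    exact: natr_card_neq0.
- apply: (@exp_circuit_symmetric _ _ _ _ _ _ (actperm A)) => g; last exact: msym_reynolds.
  by move=> z; rewrite actpermE.
- rewrite /system_size (addnC m); apply: leq_trans (exp_gate_bound N0 k0).
  by rewrite geq_max !leq_max card_exp_gate leqnn orbT.
- by rewrite leq_mul2l leq_exp2r // /system_size (addnC m) leq_maxr orbT.
- by rewrite /y_linear CQ; exact: y_linear_reynolds.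
Qed.
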